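(* Let $I\subseteq S$ be a monomial ideal, and let $I=Q_1\cap\cdots\cap Q_m$ be a primary decomposition of $I$ with monomial ideals $Q_i$. Then $I^*=Q_1^*\cap\cdots\cap Q_m^*$ is a primary decomposition of $I^*$; if the given decomposition of $I$ is irredundant, then so is this decomposition of $I^*$. In particular, $$\operatorname{Ass}(S^*/I^* )=\{P^*: P\in\operatorname{Ass}(S/I)\}.$$
   Context: Let $K$ be a field and $S=K[x_1,\ldots,x_n]$. Fix an $n$-tuple $(i_1,\ldots,i_n)$ of positive integers, let $S^*$ be the polynomial ring over $K$ in the variables $x_{jk}$, $1\le j\le n$, $1\le k\le i_j$, and set $P_j=(x_{j1},\ldots,x_{ji_j})\subseteq S^*$. For a monomial ideal $I\subseteq S$ generated by monomials $\mathbf{x}^{\mathbf{a}_1},\ldots,\mathbf{x}^{\mathbf{a}_m}$, with $\mathbf{a}_i=(a_i(1),\ldots,a_i(n))$, the expansion of $I$ is the monomial ideal $$I^*=\sum_{i=1}^m P_1^{a_i(1)}\cdots P_n^{a_i(n)}\subseteq S^*,$$ which does not depend on the choice of monomial generators. (All associated primes of a monomial ideal are monomial prime ideals, so $P^*$ is defined.) *)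

(* Defs.v *)
From HB Require Import structures.
From mathcomp Require Import all_boot all_order all_algebra.
From mathcomp Require Import mpoly.
From mathcomp Require Import boolp classical_sets.

Set Implicit Arguments.
Unset Strict Implicit.
Unset Printing Implicit Defensive.

Import GRing.Theory.
Local Open Scope classical_set_scope.
Local Open Scope ring_scope.

Section Ideals.
Variable R : comNzRingType.
Implicit Types I J P Q : set R.

(* Unlike [idealr_closed] of ring_quotient, the unit ideal is allowed. *)
Definition is_ideal I : Prop :=
  [/\ I 0, (forall x y, I x -> I y -> I (x + y)) & (forall a x, I x -> I (a * x))].

Definition ideal_gen (G : set R) : set R := smallest is_ideal G.

Definition ideal_add I J : set R := ideal_gen (I `|` J).

Definition ideal_mul I J : set R := ideal_gen [set x * y | x in I & y in J].

Definition ideal_pow I (k : nat) : set R := iter k (ideal_mul I) setT.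

Definition prime_ideal P : Prop :=
  [/\ is_ideal P, ~ P 1 & forall x y, P (x * y) -> P x \/ P y].

Definition primary_ideal Q : Prop :=
  [/\ is_ideal Q, ~ Q 1 &
      forall x y, Q (x * y) -> Q x \/ exists k : nat, Q (y ^+ k)].

Definition radical I : set R := [set x | exists k : nat, I (x ^+ k)].

(* The associated primes of the R-module R/I: [set g | I (g * f)] is the
   annihilator of the class of f. *)
Definition Ass I : set (set R) :=
  [set P | prime_ideal P /\ exists f : R, P = [set g | I (g * f)]].

Section Decomposition.
Variables (m : nat) (Q : 'I_m -> set R).

Definition primary_decomposition I : Prop :=
  (forall i, primary_ideal (Q i)) /\ I = \bigcap_i Q i.

Definition irredundant : Prop :=
  forall i, \bigcap_(j in [set j | j != i]) Q j <> \bigcap_j Q j.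

(* Some authors reserve "irredundant" for this stronger property. *)
Definition strongly_irredundant : Prop :=
  irredundant /\ forall i j, i <> j -> radical (Q i) <> radical (Q j).

End Decomposition.

Lemma ideal_gen_ideal (G : set R) : is_ideal (ideal_gen G).
Proof.
split=> [J [[J0 _ _] _] //|x y hx hy J hJ|a x hx J hJ]; have [[_ JD JM] _] := hJ.
  by apply: JD; [apply: hx | apply: hy].
by apply: JM; apply: hx.
Qed.

Lemma sub_ideal_gen (G : set R) : G `<=` ideal_gen G.
Proof. exact: sub_smallest. Qed.

Lemma ideal_gen_min (G J : set R) :
  is_ideal J -> G `<=` J -> ideal_gen G `<=` J.
Proof. exact: smallest_sub. Qed.

Lemma ideal_mulS (I1 I2 J1 J2 : set R) :
  I1 `<=` J1 -> I2 `<=` J2 -> ideal_mul I1 I2 `<=` ideal_mul J1 J2.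
Proof.
move=> h1 h2; apply: ideal_gen_min => [|x [y hy [z hz <-]]].
  exact: ideal_gen_ideal.
apply: sub_ideal_gen; by exists y; [exact: h1 | exists z; [exact: h2 |]].
Qed.

Lemma ideal_pow_ideal (I : set R) k : is_ideal (ideal_pow I k).
Proof. by case: k => [|k]; [split | exact: ideal_gen_ideal]. Qed.

Lemma ideal_pow_anti (I : set R) k l :
  (k <= l)%N -> ideal_pow I l `<=` ideal_pow I k.
Proof.
move/subnK <-; elim: (l - k)%N => // {}l IHl.
apply: subset_trans IHl; rewrite addSn.
apply: ideal_gen_min; first exact: ideal_pow_ideal.
have [_ _ idM] := ideal_pow_ideal I (l + k).
by move=> _ [x _ [y hy <-]]; exact: idM.
Qed.

End Ideals.

Section Expansion.
Variables (K : fieldType) (n : nat).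

Definition mon_ideal (s : seq 'X_{1..n}) : set {mpoly K[n]} :=
  ideal_gen [set 'X_[K, a] | a in [set a | a \in s]].

Definition monomial_ideal (I : set {mpoly K[n]}) : Prop :=
  exists s : seq 'X_{1..n}, I = mon_ideal s.

Variable d : 'I_n -> nat.

(* The variable x_{jk} is the [tagnat.Rank j k]-th variable. *)
Definition expansion_ring := {mpoly K[\sum_(j < n) d j]}.

Definition xvar (j : 'I_n) (k : 'I_(d j)) : expansion_ring :=
  'X_(tagnat.Rank j k).

Definition block_prime (j : 'I_n) : set expansion_ring :=
  ideal_gen (range (@xvar j)).

Definition expansion_of_gens (s : seq 'X_{1..n}) : set expansion_ring :=
  \big[@ideal_add expansion_ring/[set 0]]_(a <- s)
     \big[@ideal_mul expansion_ring/setT]_(j < n)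
        ideal_pow (block_prime j) (a j).

(* By [expansionE] below, all the terms of this union are equal when I is a
   monomial ideal; the union is empty when I is not a monomial ideal. *)
Definition expansion (I : set {mpoly K[n]}) : set expansion_ring :=
  \bigcup_(s in [set s | mon_ideal s = I]) expansion_of_gens s.

Lemma mon_idealX (s : seq 'X_{1..n}) (a : 'X_{1..n}) :
  mon_ideal s 'X_[a] -> exists2 b, b \in s & (b <= a)%MM.
Proof.
pose J := [set f : {mpoly K[n]} |
  forall m, m \in msupp f -> exists2 b, b \in s & (b <= m)%MM].
suff sJ : mon_ideal s `<=` J by move/sJ; apply; rewrite msuppX inE.
apply: ideal_gen_min => [|_ [b bs <-] m].
  split=> [m|f g hf hg m|f g hg m]; first by rewrite msupp0 inE.
    by move/msuppD_le; rewrite mem_cat => /orP[/hf|/hg].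
  move/msuppM_le/allpairsP=> [[u v] /= [_ /hg[b bs bv] ->]].
  by exists b => //; apply: (lepm_trans bv); exact: lem_addl.
by rewrite msuppX inE => /eqP ->; exists b => //; exact: lepm_refl.
Qed.

Lemma expansion_of_gens_ideal s : is_ideal (expansion_of_gens s).
Proof.
rewrite /expansion_of_gens; case: s => [|a s]; last by rewrite big_cons; exact: ideal_gen_ideal.
by rewrite big_nil; split=> [//|_ _ -> ->|a _ ->]; rewrite ?addr0 ?mulr0.
Qed.

Lemma sub_expansion_of_gens (s : seq 'X_{1..n}) (a : 'X_{1..n}) : a \in s ->
  \big[@ideal_mul expansion_ring/setT]_(j < n) ideal_pow (block_prime j) (a j)
    `<=` expansion_of_gens s.
Proof.
rewrite /expansion_of_gens; elim: s => // b s IHs.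
rewrite inE big_cons => /orP[/eqP <-|/IHs {}IHs] f hf; apply: sub_ideal_gen.
  by left.
by right; exact: IHs.
Qed.

Lemma expansion_of_gensS (s t : seq 'X_{1..n}) :
  mon_ideal s `<=` mon_ideal t -> expansion_of_gens s `<=` expansion_of_gens t.
Proof.
move=> st.
have {st} : forall a, a \in s -> exists2 b, b \in t & (b <= a)%MM.
  move=> a as_; apply: mon_idealX; apply: st; apply: sub_ideal_gen.
  by exists a.
rewrite {1}/expansion_of_gens; elim: s => [|a s IHs] st.
  by rewrite big_nil => _ ->; have [] := expansion_of_gens_ideal t.
rewrite big_cons; apply: ideal_gen_min; first exact: expansion_of_gens_ideal.
move=> f [|]; last by apply: IHs => b bs; apply: st; rewrite inE bs orbT.
have [b bt /mnm_lepP ba] := st a (mem_head _ _).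
move=> hf; apply: (sub_expansion_of_gens bt); move: f hf.
apply: (big_ind2 (fun A B : set expansion_ring => A `<=` B)) => // [A B C D|j _].
  exact: ideal_mulS.
exact: ideal_pow_anti.
Qed.

Lemma expansionE (s : seq 'X_{1..n}) :
  expansion (mon_ideal s) = expansion_of_gens s.
Proof.
apply/seteqP; split=> [f [t /= ts] | f hf]; last by exists s.
by apply: expansion_of_gensS; rewrite ts.
Qed.

End Expansion.

Arguments expansion_ring K {n} d.
Arguments expansion_of_gens {K n} d s.
Arguments expansion {K n} d I.

(* Main.v *)
(** A polynomial of S* lies in I* iff the image of each of its monomials under
x_{jk} |-> x_j lies in I: on exponents, I* is the preimage of I under the additive
map [collapse]. For ideals spanned by monomials, being prime or primary can be
tested on exponents, and these tests pull back along additive maps. The map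
x_j |-> x_{j1} pulls I* back to I, which reflects irredundancy, radicals and
primality. Finally, every associated prime of a monomial ideal J is (J : u) for a
monomial u, and colons by monomials commute with expansion. *)

Require Import Defs.
From mathcomp Require Import all_boot all_order all_algebra.
From mathcomp Require Import mpoly.
From mathcomp Require Import boolp classical_sets.

Set Implicit Arguments.
Unset Strict Implicit.
Unset Printing Implicit Defensive.

Import GRing.Theory.
Local Open Scope classical_set_scope.
Local Open Scope ring_scope.

(** * Finite sums and radicals in ideals of a commutative ring *)

Section IdealFacts.
Variable R : comNzRingType.
Implicit Types I : set R.

Lemma ideal_sum I (T : eqType) (r : seq T) (F : T -> R) :
  is_ideal I -> (forall i, i \in r -> I (F i)) -> I (\sum_(i <- r) F i).
Proof.
move=> [I0 ID _] IF; rewrite big_seq_cond.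
by apply: (big_ind I) => // i /andP[/IF].
Qed.

Lemma idealN I x : is_ideal I -> I x -> I (- x).
Proof. by move=> [_ _ IM] Ix; rewrite -mulN1r; apply: IM. Qed.

Lemma radical_ideal I : is_ideal I -> is_ideal (radical I).
Proof.
move=> idI; have [I0 ID IM] := idI; split.
- by exists 1%N; rewrite expr1.
- move=> x y [k Ixk] [l Iyl]; exists (k + l)%N; rewrite exprDn.
  apply: ideal_sum => // i _; rewrite -mulr_natl; apply: (IM).
  (* The binomial term contains x^(k+l-i) y^i: if l <= i, it is a multiple of y^l; otherwise k+l-i
     >= k and it is a multiple of x^k. *)
  have [leki | /ltnW leik] := leqP l i.
    by apply: (IM); rewrite -(subnK leki) exprD; apply: (IM).
  by rewrite mulrC -addnBA // exprD [x ^+ k * _]mulrC mulrA; apply: (IM).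
- move=> a x [k Ixk]; exists k; rewrite exprMn; exact: IM.
Qed.

End IdealFacts.

Lemma mem_ideal_mul_big (R : comNzRingType) (T : Type) (r : seq T)
    (A : T -> set R) (F : T -> R) : (forall i, A i (F i)) ->
  (\big[@ideal_mul R/setT]_(i <- r) A i) (\prod_(i <- r) F i).
Proof.
move=> AF; elim: r => [|i r IHr]; first by rewrite !big_nil.
rewrite !big_cons; apply: sub_ideal_gen.
by exists (F i) => //; exists (\prod_(j <- r) F j).
Qed.

(** * Ideals spanned by monomials, described by their exponents *)

Section SupportedIn.
Variables (K : fieldType) (n : nat).
Implicit Types (M : set 'X_{1..n}) (f g : {mpoly K[n]}).

(** These are the ideals of the additive monoid of exponents. *)
Definition mnm_ideal M := forall a b, M b -> M (a + b)%MM.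

(** This is the K-span of the monomials with exponent in M. The set M is arbitrary because
    complements of exponent ideals occur as well. *)
Definition supported_in M : set {mpoly K[n]} :=
  [set f | forall m, m \in msupp f -> M m].

Definition exponents (I : set {mpoly K[n]}) : set 'X_{1..n} :=
  [set m | I 'X_[m]].

Lemma supported_inX M m : supported_in M 'X_[m] <-> M m.
Proof.
split=> [|Mm u]; first by apply; rewrite msuppX inE.
by rewrite msuppX inE => /eqP ->.
Qed.

Lemma exponents_supported_in M : exponents (supported_in M) = M.
Proof. by apply/seteqP; split=> m /supported_inX. Qed.

Lemma supported_in0 M : supported_in M 0.
Proof. by move=> m; rewrite msupp0. Qed.

Lemma supported_inD M f g :
  supported_in M f -> supported_in M g -> supported_in M (f + g).
Proof. by move=> Mf Mg m /msuppD_le; rewrite mem_cat => /orP[/Mf|/Mg]. Qed.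

(** Three separate sets serve two purposes: absorption in an ideal, and products of polynomials
    supported outside a prime or primary exponent set. *)
Lemma supported_inM M1 M2 M f g :
    (forall a b, M1 a -> M2 b -> M (a + b)%MM) ->
  supported_in M1 f -> supported_in M2 g -> supported_in M (f * g).
Proof.
move=> M12 Mf Mg m /msuppM_le/allpairsP[[a b] /= [/Mf? /Mg? ->]].
exact: M12.
Qed.

Lemma supported_in_ideal M : mnm_ideal M -> is_ideal (supported_in M).
Proof.
move=> idM; split; [exact: supported_in0 | exact: supported_inD |].
by move=> a x; apply: (@supported_inM setT M) => // u v _; apply: idM.
Qed.

Lemma supported_in_disjoint M f :
  supported_in M f -> supported_in (~` M) f -> f = 0.
Proof.
move=> Mf nMf; apply/eqP; rewrite -msupp_eq0.
case E: (msupp f) => [//|m s]; have mf : m \in msupp f by rewrite E mem_head.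
by have := nMf m mf (Mf m mf).
Qed.

(** This is the linear projection onto the span of the monomials in M along the span of those
    outside M. *)
Definition mrestrict M f : {mpoly K[n]} :=
  \sum_(m <- [seq m <- msupp f | `[< M m >]]) f@_m *: 'X_[m].

Lemma msupp_mrestrict M f :
  perm_eq (msupp (mrestrict M f)) [seq m <- msupp f | `[< M m >]].
Proof.
apply: msupp_sumX; first by rewrite filter_uniq ?msupp_uniq.
by move=> m; rewrite mem_filter mcoeff_msupp => /andP[].
Qed.

Lemma mrestrictP M f : supported_in M (mrestrict M f).
Proof.
by move=> m; rewrite (perm_mem (msupp_mrestrict M f)) mem_filter => /andP[/asboolP].
Qed.

Lemma mrestrictD M f : mrestrict M f + mrestrict (~` M) f = f.
Proof.
rewrite [RHS]mpolyE /mrestrict !big_filter [RHS](bigID (fun m => `[< M m >])) /=.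
by congr (_ + _); apply: eq_bigl => m; rewrite asbool_neg.
Qed.

Lemma ideal_supported (I : set {mpoly K[n]}) f :
  is_ideal I -> supported_in (exponents I) f -> I f.
Proof.
move=> idI If; have [_ _ IM] := idI.
rewrite [f]mpolyE; apply: ideal_sum => // m /If Im.
by rewrite -mul_mpolyC; apply: IM.
Qed.

Lemma mon_ideal_ideal s : is_ideal (@mon_ideal K n s).
Proof. exact: ideal_gen_ideal. Qed.

Lemma mon_idealE s :
  mon_ideal s = supported_in [set m | exists2 b, b \in s & (b <= m)%MM].
Proof.
have up : mnm_ideal [set m | exists2 b, b \in s & (b <= m)%MM].
  by move=> a m [b bs bm]; exists b => //; apply: (lepm_trans bm); apply: lem_addl.
apply/seteqP; split=> [|f sf].
  apply: ideal_gen_min; first exact: supported_in_ideal.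
  by move=> _ [b bs <-]; apply/supported_inX; exists b => //; apply: lepm_refl.
apply: ideal_supported => [|m /sf[b bs /submK <-]]; first exact: mon_ideal_ideal.
have [_ _ IM] := mon_ideal_ideal s.
rewrite /exponents /= mpolyXD; apply: IM.
by apply: sub_ideal_gen; exists b.
Qed.

Lemma monomial_ideal_ideal I : @monomial_ideal K n I -> is_ideal I.
Proof. by move=> [s ->]; exact: mon_ideal_ideal. Qed.

Lemma monomial_idealE I :
  @monomial_ideal K n I -> I = supported_in (exponents I).
Proof. by move=> [s ->]; rewrite mon_idealE exponents_supported_in. Qed.

Lemma exponents_ideal I : is_ideal I -> mnm_ideal (exponents I).
Proof. by move=> [_ _ IM] a b; rewrite /exponents /= mpolyXD; apply: IM. Qed.

(** * Prime and primary ideals tested on exponents *)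

Definition mnm_primary M :=
  [/\ mnm_ideal M, ~ M 0%MM &
      forall a b, M (a + b)%MM -> M a \/ exists k, M (b *+ k)%MM].

Definition mnm_prime M :=
  [/\ mnm_ideal M, ~ M 0%MM & forall a b, M (a + b)%MM -> M a \/ M b].

Lemma exponents_primary Q : primary_ideal Q -> mnm_primary (exponents Q).
Proof.
move=> [idQ Q1 QM]; split; rewrite /exponents /=; first exact: exponents_ideal.
  by rewrite mpolyX0.
move=> a b; rewrite mpolyXD => /QM[|[k Qk]]; first by left.
by right; exists k; rewrite -mpolyXn.
Qed.

Lemma exponents_prime P : prime_ideal P -> mnm_prime (exponents P).
Proof.
move=> [idP P1 PM]; split; rewrite /exponents /=; first exact: exponents_ideal.
  by rewrite mpolyX0.
by move=> a b; rewrite mpolyXD => /PM.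
Qed.

(** Let f0 and g0 be the components of f and g outside M. Their product is congruent to f g modulo
    the ideal, hence supported in M. Since exponents outside M are closed under addition, it is also
    supported outside M, so it vanishes; the polynomial ring being a domain, f0 or g0 is zero. *)
Lemma supported_in_prime M : mnm_prime M -> prime_ideal (supported_in M).
Proof.
move=> [idM M0 MD]; have idJ := supported_in_ideal idM.
have [_ JD JM] := idJ; split=> //.
  by rewrite -mpolyX0 supported_inX.
move=> f g Jfg; set f0 := mrestrict (~` M) f; set g0 := mrestrict (~` M) g.
have fE := mrestrictD M f; have gE := mrestrictD M g.
have : f0 * g0 = 0.
  apply: (@supported_in_disjoint M); last first.
    apply: (@supported_inM (~` M) (~` M)); try exact: mrestrictP.
    by move=> a b Ma Mb /MD[].
  have -> : f0 * g0 = f * g - (f * mrestrict M g + g0 * mrestrict M f).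
    rewrite opprD addrA -mulrBr -{1}gE addrAC subrr add0r -/g0.
    by rewrite [g0 * _]mulrC -mulrBl -{1}fE addrAC subrr add0r.
  apply: (JD) => //; apply: (idealN idJ).
  by apply: (JD); apply: (JM); apply: mrestrictP.
move/eqP; rewrite mulf_eq0 => /orP[] /eqP z0; [left|right].
  by rewrite -fE -/f0 z0 addr0; apply: mrestrictP.
by rewrite -gE -/g0 z0 addr0; apply: mrestrictP.
Qed.

Lemma supported_in_primary M : mnm_primary M -> primary_ideal (supported_in M).
Proof.
move=> [idM M0 MD]; have idJ := supported_in_ideal idM.
have [_ JD JM] := idJ; split=> //.
  by rewrite -mpolyX0 supported_inX.
(* N is the radical of M; modulo J = [supported_in M], the component of g outside N has a power that is a
   multiple of g. *)
pose N := [set b | exists k, M (b *+ k)%MM].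
have [_ rD rM] := radical_ideal idJ.
have NJ : supported_in N `<=` radical (supported_in M).
  move=> g Ng; apply: ideal_supported; first exact: radical_ideal.
  move=> b /Ng[k Mk]; exists k; rewrite mpolyXn; exact/supported_inX.
move=> f g Jfg; set f0 := mrestrict (~` M) f; set g0 := mrestrict (~` N) g.
have fE := mrestrictD M f; have gE := mrestrictD N g.
have [k Jk] : radical (supported_in M) (- mrestrict N g).
  by apply: idealN; [exact: radical_ideal | apply: NJ; apply: mrestrictP].
(* An exponent outside M plus one outside N stays outside M, so this product is supported outside M;
   it remains to see that it lies in J. *)
have : f0 * g0 ^+ k = 0.
  apply: (@supported_in_disjoint M); last first.
    elim: k {Jk} => [|k IHk]; first by rewrite mulr1; apply: mrestrictP.
    rewrite exprSr mulrA; apply: (@supported_inM (~` M) (~` N)) => //.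
      by move=> a b nMa nNb /MD[].
    exact: mrestrictP.
  have Jf0g : supported_in M (f0 * g).
    have -> : f0 * g = f * g - g * mrestrict M f.
      by rewrite -{1}fE -/f0 mulrDl [g * _]mulrC addrAC subrr add0r.
    by apply: (JD) => //; apply: (idealN idJ); apply: (JM); apply: mrestrictP.
  (* Put r = [mrestrict N g]. The difference g0^k - (-r)^k is a multiple of g0 + r = g, and (-r)^k
     lies in J by the choice of k. *)
  rewrite -[g0 ^+ k](subrK ((- mrestrict N g) ^+ k)) mulrDr.
  apply: (JD); last exact: JM.
  have -> : g0 ^+ k - (- mrestrict N g) ^+ k
     = g * (\sum_(i < k) g0 ^+ (k.-1 - i) * (- mrestrict N g) ^+ i).
    rewrite subrXX opprK addrC gE.
    by congr (_ * _); apply: eq_bigr => i _; rewrite -subn1 subnDA addnC subnDA subn1.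
  by rewrite mulrA mulrC; apply: JM.
move/eqP; rewrite mulf_eq0 => /orP[/eqP z0|/eqP z0]; [left|right].
  by rewrite -fE -/f0 z0 addr0; apply: mrestrictP.
apply: NJ; rewrite -gE -/g0.
have /eqP -> : g0 == 0 by move/eqP: z0; rewrite expf_eq0 => /andP[].
by rewrite addr0; apply: mrestrictP.
Qed.

(** * Colons by monomials and associated primes *)

Lemma supported_in_colonX M u :
  [set g | supported_in M (g * 'X_[u])] = supported_in [set m | M (u + m)%MM].
Proof.
apply/seteqP; split=> g /= Mg m.
  by move=> mg; apply: Mg; rewrite (perm_mem (msuppMX _ _)) map_f.
by rewrite (perm_mem (msuppMX _ _)) => /mapP[v vg ->]; apply: Mg.
Qed.

(* With J = [supported_in M], among the f with P = (J : f), take one with the fewest monomials: for a monomial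
   v outside P, also P = (J : v f), so by minimality no term of v f lies in J. Hence
   P and (J : u) contain the same monomials, for any monomial u of f. *)
Lemma Ass_supported_in M P : mnm_ideal M -> Ass (supported_in M) P ->
  exists u, P = [set g | supported_in M (g * 'X_[u])].
Proof.
move=> idM [Pprime [f0 Pf0]]; have [idP P1 PM] := Pprime.
have idJ := supported_in_ideal idM; have [_ JD JM] := idJ.
pose size_ann k :=
  `[< exists f, size (msupp f) = k /\ P = [set g | supported_in M (g * f)] >].
have ex_ann : exists k, size_ann k.
  by exists (size (msupp f0)); apply/asboolP; exists f0.
case: (ex_minnP ex_ann) => _ /asboolP[f [<- Pf]] minf.
(* Dropping the terms of h that lie in J changes h only modulo J, hence does not change the
   colon. *)
have colon_restrict h : [set g | supported_in M (g * mrestrict (~` M) h)] =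
    [set g | supported_in M (g * h)].
  have hE := mrestrictD M h.
  have Jr g : supported_in M (g * mrestrict M h) by apply: JM; apply: mrestrictP.
  apply/seteqP; split=> g /= Jg; first by rewrite -hE mulrDr; apply: JD.
  rewrite -[mrestrict _ _](addKr (mrestrict M h)) hE mulrDr mulrN.
  by apply: JD => //; apply: (idealN idJ).
have reduced h : P = [set g | supported_in M (g * h)] ->
    (size (msupp h) <= size (msupp f))%N -> supported_in (~` M) h.
  rewrite -colon_restrict => Ph le_hf m mh Mm.
  have := minf (size (msupp (mrestrict (~` M) h))).
  rewrite leqNgt => /(_ _)/negP; apply; first by apply/asboolP; exists (mrestrict (~` M) h).
  apply: leq_trans le_hf; rewrite (perm_size (msupp_mrestrict _ _)) size_filter.
  rewrite -(count_predC (fun m => `[< (~` M) m >]) (msupp h)) -[X in (X < _)%N]addn0 ltn_add2l.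
  by rewrite -has_count; apply/hasP; exists m => //=; apply/negP=> /asboolP.
have fred := reduced f Pf (leqnn _).
have expP v u : u \in msupp f -> P 'X_[v] <-> M (u + v)%MM.
  move=> uf; split=> [|Muv].
    rewrite Pf /= mulrC => Jv; apply: Jv.
    by rewrite (perm_mem (msuppMX _ _)) addmC map_f.
  apply: contrapT => nPv.
  have := reduced (f * 'X_[v]); rewrite (perm_size (msuppMX _ _)) size_map.
  move=> /(_ _ (leqnn _)) red.
  suff /red /(_ (u + v)%MM) : P = [set g | supported_in M (g * (f * 'X_[v]))].
    by rewrite (perm_mem (msuppMX _ _)) addmC map_f // => /(_ isT); rewrite addmC.
  (* With v standing for its monomial, (J : f v) = (P : v), which is P because P is prime and v is
     not in P. *)
  apply/seteqP; split=> g /=.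
    by rewrite Pf /= mulrA [_ * 'X_[v]]mulrC => Jg; apply: (JM).
  rewrite [f * _]mulrC mulrA => Jg.
  by have /PM[] : P (g * 'X_[v]) by rewrite Pf.
have fN0 : f != 0.
  by apply/eqP=> f0E; apply: P1; rewrite Pf /= f0E mulr0; apply: supported_in0.
(* The leading exponent is chosen to show that P is spanned by monomials. If g in P had a nonzero
   component g0 outside (J : u), then f g0 would lie in J with leading exponent u + [mlead g0], so
   the leading monomial of g0 would lie in (J : u). *)
have uf := mlead_supp fN0; set u := mlead f in uf; exists u.
rewrite supported_in_colonX; apply/seteqP; split=> g; last first.
  move=> Mg; apply: ideal_supported => // m /Mg; exact: (expP _ _ uf).2.
move=> Pg; set M' := [set m | _].
have M'P : supported_in M' `<=` P.
  by move=> h Mh; apply: ideal_supported => // m /Mh; exact: (expP _ _ uf).2.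
have gE := mrestrictD M' g; set g0 := mrestrict (~` M') g in gE.
suff g00 : g0 = 0 by rewrite -gE g00 addr0; apply: mrestrictP.
apply/eqP; apply: contraPT isT => g0N0 _.
have Pg0 : P g0.
  rewrite -[g0](addKr (mrestrict M' g)) gE; have [_ PD _] := idP.
  by apply: PD => //; apply: (idealN idP); apply: M'P; apply: mrestrictP.
have lg : mlead g0 \in msupp g0 by apply: mlead_supp.
apply: (mrestrictP lg); rewrite /M' /= -mleadM //.
by move: Pg0; rewrite Pf /= mulrC; apply; rewrite mlead_supp // mulf_neq0.
Qed.

(** The generators are the quotients b / gcd(b, u), whose exponents are the truncated differences b
    - u; indeed b - u <= m exactly when b <= u + m. *)
Lemma monomial_ideal_colonX I u :
  @monomial_ideal K n I -> monomial_ideal [set g | I (g * 'X_[u])].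
Proof.
move=> [s ->]; exists [seq (b - u)%MM | b <- s].
rewrite !mon_idealE supported_in_colonX; congr supported_in.
have le b m : ((b - u <= m) = (b <= u + m))%MM.
  by apply/mnm_lepP/mnm_lepP=> h i; have := h i; rewrite mnmBE mnmDE leq_subLR.
apply/seteqP; split=> m /=.
  by move=> [b bs bm]; exists (b - u)%MM; [exact: map_f | rewrite le].
by move=> [_ /mapP[b bs ->]]; rewrite le; exists b.
Qed.

End SupportedIn.

(** * The expansion as a preimage on exponents *)

Section Expansion.
Variables (K : fieldType) (n : nat) (d : 'I_n -> nat).
Local Notation N := (\sum_(j < n) d j)%N.
Implicit Types (a b : 'X_{1..n}) (m : 'X_{1..N}).

(* The exponent of the image of the monomial m under x_{jk} |-> x_j. *)
Definition collapse m : 'X_{1..n} :=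
  [multinom (\sum_(i < N | tagnat.sig1 i == j) m i)%N | j < n].

Lemma collapseD m1 m2 : collapse (m1 + m2)%MM = (collapse m1 + collapse m2)%MM.
Proof.
by apply/mnmP=> j; rewrite !mnmE -big_split; apply: eq_bigr => i _; rewrite mnmE.
Qed.

Lemma collapse0 : collapse 0%MM = 0%MM.
Proof. by apply/mnmP=> j; rewrite !mnmE big1 // => i _; rewrite mnm0E. Qed.

Lemma collapseMn m k : collapse (m *+ k)%MM = (collapse m *+ k)%MM.
Proof. by elim: k => [|k IHk]; rewrite ?mulm0n ?collapse0 // !mulmS collapseD IHk. Qed.

Lemma collapseU (i : 'I_N) : collapse U_(i)%MM = U_(tagnat.sig1 i)%MM.
Proof.
apply/mnmP=> j; rewrite mnmE mnm1E big_mkcond /= (bigD1 i) //= mnm1E eqxx.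
rewrite big1 => [|k /negPf ki]; first by rewrite addn0; case: eqP.
by rewrite mnm1E [i == k]eq_sym ki if_same.
Qed.

(** These turn out to be the exponents of the monomials in P_1^{a(1)}...P_n^{a(n)};
    [block_product_sub] and [block_productX] give the two inclusions. *)
Definition collapse_ge a : set 'X_{1..N} := [set m | (a <= collapse m)%MM].

Lemma collapse_ge_ideal a : mnm_ideal (collapse_ge a).
Proof.
move=> m1 m2; rewrite /collapse_ge /= collapseD => /lepm_trans; apply.
by rewrite addmC; apply: lem_addr.
Qed.

Lemma ideal_mul_collapse_ge (I J : set (expansion_ring K d)) a b :
    I `<=` supported_in (collapse_ge a) -> J `<=` supported_in (collapse_ge b) ->
  ideal_mul I J `<=` supported_in (collapse_ge (a + b)%MM).
Proof.
move=> Ia Jb; apply: ideal_gen_min.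
  exact: (supported_in_ideal K (@collapse_ge_ideal _)).
move=> _ [x /Ia xa [y /Jb yb <-]]; apply: (supported_inM _ xa yb) => m1 m2 am bm.
rewrite /collapse_ge /= collapseD; apply/mnm_lepP=> i.
by rewrite !mnmDE leq_add // (mnm_lepP _).
Qed.

Definition block_product a : set (expansion_ring K d) :=
  \big[@ideal_mul _/setT]_(j < n) ideal_pow (@block_prime K n d j) (a j).

Lemma block_product_sub a : block_product a `<=` supported_in (collapse_ge a).
Proof.
have ge0 : [set: expansion_ring K d] `<=` supported_in (collapse_ge 0%MM).
  by move=> f _ m _; apply/mnm_lepP=> i; rewrite mnm0E.
(* Writing a as the sum of its parts a(j) U_j lets the induction match each factor of the product of
   ideals with a summand. *)
rewrite [in X in _ `<=` X](multinomUE_id a).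
rewrite /block_product.
apply: (big_ind2 (fun I b => I `<=` supported_in (collapse_ge b))) => //.
  by move=> I b J c; apply: ideal_mul_collapse_ge.
move=> j _; elim: (a j) => [|k IHk] //.
rewrite mulmS; apply: ideal_mul_collapse_ge => //.
apply: ideal_gen_min; first exact: (supported_in_ideal K (@collapse_ge_ideal _)).
move=> _ [k' _ <-]; apply/supported_inX.
by rewrite /collapse_ge /= collapseU tagnat.Rank1K; apply: lepm_refl.
Qed.

(** A monomial of positive degree in block j is divisible by some variable of that block; removing
    it lowers this degree by one. *)
Lemma ideal_powX j k m : (k <= collapse m j)%N ->
  ideal_pow (@block_prime K n d j) k 'X_[m].
Proof.
elim: k m => // k IHk m lt_km.
have [i /eqP ij mi] : exists2 i : 'I_N, tagnat.sig1 i == j & (0 < m i)%N.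
  apply: contrapT => no; move: lt_km; rewrite mnmE big1 // => i ij.
  by apply/eqP; rewrite -leqn0 leqNgt; apply/negP => mi; apply: no; exists i.
have mE : m = (U_(i) + (m - U_(i)))%MM.
  rewrite addmC submK //; apply/mnm_lepP=> i'; rewrite mnm1E.
  by case: eqP => // <-.
rewrite mE mpolyXD; apply: sub_ideal_gen; exists 'X_i.
  subst j; apply: sub_ideal_gen; exists (tagnat.sig2 i) => //.
  by rewrite /xvar tagnat.sig2K.
exists 'X_[(m - U_(i))] => //; apply: IHk.
by move: lt_km; rewrite {1}mE collapseD mnmDE collapseU ij mnm1E eqxx.
Qed.

Lemma block_productX a m : collapse_ge a m -> block_product a 'X_[m].
Proof.
move=> /mnm_lepP am.
(* The monomial factors into its block components, the j-th of which lies in P_j^{a(j)}. *)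
pose part j : 'X_{1..N} := [multinom if tagnat.sig1 i == j then m i else 0%N | i < N].
have -> : m = (\sum_(j < n) part j)%MM.
  apply/mnmP=> i; rewrite mnm_sumE [RHS](bigD1 (tagnat.sig1 i)) //= mnmE eqxx
    [X in (_ + X)%N]big1 ?addn0 //.
  by move=> j; rewrite mnmE eq_sym => /negPf ->.
rewrite -mprodXE; apply: mem_ideal_mul_big => j; apply: ideal_powX.
apply: leq_trans (am j) _; rewrite !mnmE; apply: leq_sum => i ij.
by rewrite mnmE ij.
Qed.

Lemma expansion_ideal (I : set {mpoly K[n]}) :
  monomial_ideal I -> is_ideal (expansion d I).
Proof. by move=> [s ->]; rewrite expansionE; exact: expansion_of_gens_ideal. Qed.

(** Each generator a contributes the monomials m with a <= [collapse m]; over all generators, this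
    says that [collapse m] is an exponent of I. *)
Lemma expansion_supported (I : set {mpoly K[n]}) : monomial_ideal I ->
  expansion d I = supported_in (collapse @^-1` exponents I).
Proof.
move=> [s ->]; rewrite expansionE mon_idealE exponents_supported_in.
set M := _ @^-1` _; apply/seteqP; split.
  have idM : is_ideal (@supported_in K N M).
    apply: supported_in_ideal => a b [c cs cb]; exists c => //.
    by apply: collapse_ge_ideal.
  rewrite /expansion_of_gens big_seq.
  apply: (big_ind (fun A : set (expansion_ring K d) => A `<=` supported_in M)).
  - by move=> _ ->; apply: supported_in0.
  - by move=> A B AM BM; apply: ideal_gen_min => // f [/AM|/BM].
  - by move=> a as_ f /block_product_sub fa m /fa am; exists a.
move=> f Mf; apply: ideal_supported; first exact: expansion_of_gens_ideal.
move=> m /Mf[a as_ am]; apply: (sub_expansion_of_gens as_); exact: block_productX.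
Qed.

Lemma expansion_primary (Q : set {mpoly K[n]}) :
  monomial_ideal Q -> primary_ideal Q -> primary_ideal (expansion d Q).
Proof.
move=> Qmon /exponents_primary[idQ Q0 QD]; rewrite expansion_supported //.
apply: supported_in_primary; split=> [a b|/=|a b] /=; rewrite ?collapseD ?collapse0 //.
  exact: idQ.
by move=> /QD[|[k Qk]]; [left | right; exists k; rewrite /= collapseMn].
Qed.

Lemma expansion_prime (P : set {mpoly K[n]}) :
  monomial_ideal P -> prime_ideal P -> prime_ideal (expansion d P).
Proof.
move=> Pmon /exponents_prime[idP P0 PD]; rewrite expansion_supported //.
apply: supported_in_prime; split=> [a b|/=|a b] /=; rewrite ?collapseD ?collapse0 //.
  exact: idP.
exact: PD.
Qed.

(** * Embedding S into S* and retracting back *)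

Hypothesis d_gt0 : forall j, (0 < d j)%N.

Definition first_var (j : 'I_n) : 'I_N := tagnat.Rank j (Ordinal (d_gt0 j)).

Definition lift_first (f : {mpoly K[n]}) : expansion_ring K d :=
  f \mPo [tuple 'X_(first_var j) | j < n].

Definition collapse_poly (f : expansion_ring K d) : {mpoly K[n]} :=
  f \mPo [tuple 'X_(tagnat.sig1 i) | i < N].

Definition section_mnm a : 'X_{1..N} := (\sum_(j < n) U_(first_var j) *+ a j)%MM.

Lemma section_mnmK a : collapse (section_mnm a) = a.
Proof.
rewrite [RHS]multinomUE_id /section_mnm (big_morph collapse collapseD collapse0).
by apply: eq_bigr => j _; rewrite collapseMn collapseU tagnat.Rank1K.
Qed.

Lemma lift_firstX a : lift_first 'X_[a] = 'X_[section_mnm a].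
Proof.
rewrite /lift_first comp_mpolyX -mprodXE.
by apply: eq_bigr => j _; rewrite tnth_mktuple mpolyXn.
Qed.

Lemma collapse_polyX m : collapse_poly 'X_[m] = 'X_[collapse m].
Proof.
rewrite [in RHS](multinomUE_id m) (big_morph collapse collapseD collapse0).
rewrite /collapse_poly comp_mpolyX -mprodXE; apply: eq_bigr => i _.
by rewrite tnth_mktuple mpolyXn collapseMn collapseU.
Qed.

Lemma lift_firstK : cancel lift_first collapse_poly.
Proof.
move=> f; rewrite [f in LHS]mpolyE [RHS]mpolyE /lift_first (raddf_sum (comp_mpoly _)).
rewrite /collapse_poly (raddf_sum (comp_mpoly _)) /=.
apply: eq_bigr => a _; rewrite !comp_mpolyZ; congr (_ *: _).
rewrite -[LHS]/(collapse_poly (lift_first 'X_[a])).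
by rewrite lift_firstX collapse_polyX section_mnmK.
Qed.

(** The retraction [collapse_poly] carries I* into I, which gives one direction. Conversely,
    [lift_first] sends the monomial of a to that of [section_mnm a], which collapses to a. *)
Lemma expansion_lift_first (I : set {mpoly K[n]}) f :
  monomial_ideal I -> expansion d I (lift_first f) <-> I f.
Proof.
move=> Imon; have idI := monomial_ideal_ideal Imon.
have idE := expansion_ideal Imon.
have [_ _ IM] := idI; have [_ _ EM] := idE.
split=> [|If].
  rewrite -{2}[f]lift_firstK; move: (lift_first f) => g.
  rewrite expansion_supported // => Ig.
  rewrite [g]mpolyE /collapse_poly (raddf_sum (comp_mpoly _)) /=; apply: ideal_sum => // m /Ig Im.
  rewrite comp_mpolyZ -mul_mpolyC; apply: IM.
  by rewrite -[X in I X]/(collapse_poly _) collapse_polyX.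
rewrite [f]mpolyE /lift_first (raddf_sum (comp_mpoly _)) /=; apply: ideal_sum => // m mf.
rewrite comp_mpolyZ -mul_mpolyC; apply: EM.
rewrite -[X in expansion d I X]/(lift_first _) lift_firstX expansion_supported //.
apply/supported_inX; rewrite /= section_mnmK.
by rewrite (monomial_idealE Imon) in If; apply: If.
Qed.

Lemma lift_firstXn f k : lift_first (f ^+ k) = lift_first f ^+ k.
Proof. by rewrite /lift_first rmorphXn. Qed.

End Expansion.

(** * Radicals, colons, intersections and associated primes under expansion *)

Lemma expansion_radical_lift_first (K : fieldType) (n : nat) (d : 'I_n -> nat)
    (d_gt0 : forall j, (0 < d j)%N) (I : set {mpoly K[n]}) f :
  monomial_ideal I -> radical (expansion d I) (lift_first d_gt0 f) <-> radical I f.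
Proof.
move=> Imon; split=> -[k Ik]; exists k; move: Ik;
  by rewrite -lift_firstXn expansion_lift_first.
Qed.

Lemma expansion_colonX (K : fieldType) (n : nat) (d : 'I_n -> nat)
    (I : set {mpoly K[n]}) (m : 'X_{1..\sum_(j < n) d j}) : monomial_ideal I ->
  expansion d [set g | I (g * 'X_[collapse m])]
    = [set g | expansion d I (g * 'X_[m])].
Proof.
move=> Imon; rewrite !expansion_supported //; last exact: monomial_ideal_colonX.
rewrite supported_in_colonX; congr supported_in.
by apply/seteqP; split=> v /=; rewrite collapseD /exponents /= -mpolyXD addmC.
Qed.

(** Taking preimages under [collapse] commutes with intersections. *)
Lemma expansion_bigcap (K : fieldType) (n : nat) (d : 'I_n -> nat) (m : nat)
    (Q : 'I_m -> set {mpoly K[n]}) :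
  (forall i, monomial_ideal (Q i)) -> monomial_ideal (\bigcap_i Q i) ->
  expansion d (\bigcap_i Q i) = \bigcap_i expansion d (Q i).
Proof.
move=> Qmon Imon; rewrite expansion_supported //; apply/seteqP; split=> f If.
  by move=> i _; rewrite expansion_supported // => v /If; apply.
by move=> v vf i _; have := If i I; rewrite expansion_supported //; apply.
Qed.

Lemma expansion_Ass (K : fieldType) (n : nat) (d : 'I_n -> nat)
    (d_gt0 : forall j, (0 < d j)%N) (I : set {mpoly K[n]}) :
  monomial_ideal I -> Ass (expansion d I) = expansion d @` Ass I.
Proof.
move=> Imon; have idI := exponents_ideal (monomial_ideal_ideal Imon).
have idE : mnm_ideal (@collapse n d @^-1` exponents I).
  by move=> a b /=; rewrite collapseD; apply: idI.
apply/seteqP; split=> P.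
  move=> AssP; have [Pprime _] := AssP; move: AssP.
  rewrite expansion_supported // => /(Ass_supported_in idE)[w].
  rewrite -expansion_supported // -expansion_colonX // => PE.
  have Jmon := monomial_ideal_colonX (collapse w) Imon.
  exists [set g | I (g * 'X_[collapse w])] => //.
  split; last by exists 'X_[collapse w].
  (* The colon J is the preimage of the prime J* under the ring morphism [lift_first], hence
     prime. *)
  move: Pprime Jmon; rewrite PE; move: [set g | _] => J [_ J1 JM] Jmon.
  split; first exact: monomial_ideal_ideal.
    by rewrite -(expansion_lift_first d_gt0) // /lift_first comp_mpoly1.
  move=> f g; rewrite -!(expansion_lift_first d_gt0) //.
  by rewrite {1}/lift_first rmorphM => /JM.
move=> [J [Jprime JE] <-].
(* The given J is the colon by an arbitrary polynomial; a monomial u can replace it, and any lift of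
   u to S* then realizes J* as a colon of I*. *)
have [u {}JE] : exists u, J = [set g | I (g * 'X_[u])].
  rewrite (monomial_idealE Imon); apply: Ass_supported_in => //.
  by split=> //; rewrite -monomial_idealE.
split.
  apply: expansion_prime => //; rewrite JE; exact: monomial_ideal_colonX.
exists 'X_[section_mnm d_gt0 u].
by rewrite JE -expansion_colonX // section_mnmK.
Qed.

Theorem proposition1p2 (K : fieldType) (n : nat) (d : 'I_n -> nat)
    (d_gt0 : forall j, (0 < d j)%N)
    (I : set {mpoly K[n]}) (I_mon : monomial_ideal I) :
  (forall (m : nat) (Q : 'I_m -> set {mpoly K[n]}),
     (forall i, monomial_ideal (Q i)) ->
     primary_decomposition Q I ->
     [/\ primary_decomposition (fun i => expansion d (Q i)) (expansion d I),
         (irredundant Q -> irredundant (fun i => expansion d (Q i))) &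
         (strongly_irredundant Q ->
          strongly_irredundant (fun i => expansion d (Q i)))])
  /\ Ass (expansion d I) = expansion d @` Ass I.
Proof.
split; last exact: expansion_Ass.
move=> m Q Qmon [Qprim IE].
have irr : irredundant Q -> irredundant (fun i => expansion d (Q i)).
  (* If omitting the i-th component left the intersection in S* unchanged, pulling back along
     [lift_first] would make Q_i redundant in S. *)
  move=> irrQ i QE; apply: (irrQ i); apply/seteqP; split=> f Qf j ji; last exact: Qf.
  apply/(expansion_lift_first d_gt0) => //.
  have : (\bigcap_j expansion d (Q j)) (lift_first d_gt0 f).
    by rewrite -QE => k ki; apply/expansion_lift_first => //; apply: Qf.
  exact.
split=> //.
  split=> [i|]; first by apply: expansion_primary.
  by rewrite IE expansion_bigcap // -IE.
move=> [irrQ radQ]; split=> [|i j ij radE]; first exact: irr.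
apply: (radQ i j ij); apply/seteqP; split=> f /=;
  by rewrite -!(expansion_radical_lift_first d_gt0) // radE.
Qed.
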